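(* Let $1<p<\infty$, let $X$ be a $p$-smooth Banach space with constant $G_p^X$, let $1<q<\infty$ and $T>0$. Then $L^q(0,T;X)$ is $\min(p,q)$-smooth, and the constant of power-type smoothness can be chosen as $$G_q^{L^q(0,T;X)}=2^{p-q}\max\!\left(2^p,\;G_p^X+K\,2^{p-2}\right)\quad\text{if } q=\min(p,q),$$ $$G_p^{L^q(0,T;X)}=\max\!\left(2^q,\;2^{q-p}G_p^X+K\,2^{q-2}\right)+K'\,2^{p-2}\quad\text{if } p=\min(p,q),$$ where $K$ and $K'$ are the Lipschitz constants of the functions $f,g:[\tfrac12,1]\to\mathbb{R}$, $f(h)=h^{q-p}$ and $g(h)=h^{p-q}$, respectively.
   Context: For $r\ge1$ the duality mapping of a Banach space $Z$ is $J_r^Z(x)=\{x^*\in Z^*:\langle x,x^*\rangle=\|x\|\,\|x^*\|,\ \|x^*\|=\|x\|^{r-1}\}$, and $j_r^Z$ denotes a single-valued selection (unique in smooth spaces). A Banach space $Z$ is $r$-smooth (smooth of power-type $r$) with constant $G_r^Z>0$ if for all $x,y\in Z$ $$\|x-y\|^r\le\|x\|^r-r\langle j_r^Z(x),y\rangle+G_r^Z\|y\|^r .$$ The constant does not depend on $x,y$. $L^q(0,T;X)$ is the Lebesgue-Bochner space of (classes of) strongly measurable $\vartheta:[0,T]\to X$ with the standard norm $\|\vartheta\|=\left(\int_0^T\|\vartheta(t)\|_X^q\,dt\right)^{1/q}<\infty$. *)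

(* Defs.v *)
From HB Require Import structures.
From mathcomp Require Import all_boot all_order all_algebra.
From mathcomp Require Import generic_quotient ring_quotient.
From mathcomp Require Import all_classical all_reals all_analysis.
From mathcomp Require Import measurable_realfun hoelder ring lra.

Set Implicit Arguments.
Unset Strict Implicit.
Unset Printing Implicit Defensive.

Import Order.TTheory GRing.Theory Num.Theory.
Import numFieldNormedType.Exports.

Local Open Scope classical_set_scope.
Local Open Scope ring_scope.

(* A continuous linear functional on [Z] is a linear [f : Z -> R^o] that is   *)
(* continuous; the supremum in [dual_norm] is then a genuine one.             *)
Definition dual_norm (R : realType) (Z : normedModType R)
    (f : {linear Z -> R^o}) : R :=
  sup [set `|f x| | x in [set x : Z | `|x| <= 1]].

Definition duality_map (R : realType) (Z : normedModType R) (r : R) (x : Z) :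
    set {linear Z -> R^o} :=
  [set f : {linear Z -> R^o} | [/\ continuous f,
     f x = `|x| * dual_norm f & dual_norm f = `|x| `^ (r - 1)]].

(* Completeness of [Z] plays no role in this notion. For [1 < r] the          *)
(* inequality then holds for every selection, see [power_smooth_selection].   *)
Definition power_smooth (R : realType) (Z : normedModType R) (r G : R) : Prop :=
  0 < G /\
  exists2 j : Z -> {linear Z -> R^o}, (forall x, duality_map r x (j x)) &
    forall x y : Z,
      `|x - y| `^ r <= `|x| `^ r - r * j x y + G * `|y| `^ r.
Arguments power_smooth {R} Z r G.

Lemma dual_norm_ub (R : realType) (Z : normedModType R)
    (f : {linear Z -> R^o}) (z : Z) :
  continuous f -> `|f z| <= dual_norm f * `|z|.
Proof.
move=> cf.
have [M [_ fM]] := (linear_boundedP f).1 (continuous_linear_bounded 0 (cf 0)).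
have {}fM x : `|f x| <= (M + 1) * `|x| by apply: fM; rewrite ltrDl.
have hs : has_ubound [set `|f x| | x in [set x : Z | `|x| <= 1]].
  exists (`|M + 1|) => _ [x /= x1 <-]; apply: (le_trans (fM x)).
  apply: (@le_trans _ _ (`|M + 1| * `|x|)).
    by rewrite ler_wpM2r// ler_norm.
  by rewrite ler_piMr.
have [->|z0] := eqVneq z 0; first by rewrite linear0 !normr0 mulr0.
have nz : 0 < `|z| by rewrite normr_gt0.
rewrite -ler_pdivrMr//; apply: ub_le_sup => //.
exists (`|z|^-1 *: z).
  by rewrite /= normrZ normfV normr_id mulVf// gt_eqF.
by rewrite linearZ/= normrM normfV normr_id mulrC.
Qed.

Lemma duality_map_subgradient (R : realType) (Z : normedModType R) (r : R)
    (x y : Z) (f : {linear Z -> R^o}) : 1 < r -> duality_map r x f ->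
  `|x| `^ r - r * f y <= `|x - y| `^ r.
Proof.
move=> r1 [cf fx nf].
have r0 : 0 < r by rewrite (lt_trans _ r1).
have s0 : 0 < r - 1 by rewrite subr_gt0.
have fxE : f x = `|x| `^ r.
  by rewrite fx nf mulr_powRB1.
have := dual_norm_ub (x - y) cf; rewrite nf linearB/= fxE => h.
have {}h : `|x| `^ r - f y <= `|x| `^ (r - 1) * `|x - y|.
  exact: le_trans (ler_norm _) h.
have conj : (r / (r - 1))^-1 + r^-1 = 1.
  by field; rewrite !gt_eqF.
have := conjugate_powR (powR_ge0 `|x| (r - 1)) (normr_ge0 (x - y))
  (divr_gt0 r0 s0) r0 conj.
have rE : (r - 1) * (r / (r - 1)) = r by field; rewrite gt_eqF.
rewrite -powRrM rE.
move=> /(le_trans h); rewrite -(ler_pM2l r0).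
have -> : r * (`|x| `^ r / (r / (r - 1)) + `|x - y| `^ r / r) =
    (r - 1) * `|x| `^ r + `|x - y| `^ r by field; rewrite !gt_eqF.
lra.
Qed.

Lemma power_smooth_selection (R : realType) (Z : normedModType R) (r G : R) :
  1 < r -> power_smooth Z r G ->
  forall (x : Z) (f : {linear Z -> R^o}), duality_map r x f ->
  forall y, `|x - y| `^ r <= `|x| `^ r - r * f y + G * `|y| `^ r.
Proof.
move=> r1 [G0 [j Jj jG]] x f Jf y.
have r0 : 0 < r by rewrite (lt_trans _ r1).
have s0 : 0 < r - 1 by rewrite subr_gt0.
have key z : j x z <= f z.
  rewrite leNgt; apply/negP; rewrite -subr_gt0; set e := _ - _ => e0.
  pose c := G * `|z| `^ r.
  have c0 : 0 <= c by rewrite mulr_ge0 ?powR_ge0// ltW.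
  have c1 : 0 < c + 1 by rewrite ltr_wpDl.
  pose s := r * e / (c + 1); have sp : 0 < s by rewrite divr_gt0// mulr_gt0.
  pose t := s `^ (r - 1)^-1; have tp : 0 < t by rewrite powR_gt0.
  have ts : t `^ r = t * s.
    rewrite -[in LHS](subrK 1 r) powRD; last by rewrite (gt_eqF tp) implybT.
    by rewrite powRr1 ?ltW// -powRrM mulVf ?gt_eqF// powRr1 ?ltW// mulrC.
  have := le_trans (duality_map_subgradient (t *: z) r1 Jf) (jG x (t *: z)).
  rewrite normrZ powRM// gtr0_norm// ts !linearZ/= => h.
  have : t * (r * e) <= t * (s * c).
    by move: h; rewrite /e /c /= /GRing.scale/=; lra.
  rewrite ler_pM2l// leNgt => /negP; apply.
  rewrite /s mulrAC ltr_pdivrMr// ltr_pM2l ?mulr_gt0//.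
  by rewrite ltrDl.
have := key (- y); rewrite !linearN/= lerN2 => fj.
apply: le_trans (jG x y) _; rewrite lerD2r lerD2l lerN2.
by rewrite ler_pM2l.
Qed.

(* Best Lipschitz constant of [f] on [A] (when [f] is Lipschitz on [A]). *)
Definition lipschitz_constant (R : realType) (A : set R) (f : R -> R) : R :=
  inf [set k | 0 <= k /\ k.-lipschitz_A (f : R^o -> R^o)].

Section StronglyMeasurable.
Context d (T : measurableType d).

Definition simple_function (X : Type) (s : T -> X) : Prop :=
  finite_set (range s) /\ forall x, measurable (s @^-1` [set x]).

Definition strongly_measurable (R : realType) (X : normedModType R)
    (f : T -> X) : Prop :=
  exists2 s : nat -> T -> X, (forall n, simple_function (s n)) &
    forall t, s n t @[n --> \oo] --> f t.

Lemma simple_function_preimage (X : Type) (s : T -> X) (B : set X) :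
  simple_function s -> measurable (s @^-1` B).
Proof.
move=> [fs ms].
have -> : s @^-1` B = \bigcup_(x in range s `&` B) s @^-1` [set x].
  apply/seteqP; split=> [t Bt|t [x [_ Bx] /= ->]//].
  by exists (s t) => //; split => //; exists t.
by apply: fin_bigcup_measurable => [|x _]; [exact: finite_setIl|exact: ms].
Qed.

Lemma simple_function_cst (X : Type) (x : X) : simple_function (fun=> x).
Proof.
split=> [|y]; first exact: finite_image_cst.
rewrite preimage_cst; case: ifP => _; [exact: measurableT|exact: measurable0].
Qed.

Lemma simple_function_comp2 (X Y Z : Type) (g : X -> Y -> Z)
    (s : T -> X) (u : T -> Y) :
  simple_function s -> simple_function u ->
  simple_function (fun t => g (s t) (u t)).
Proof.
move=> hs hu; split.
  apply: (@sub_finite_set _ _ [set g x y | x in range s & y in range u]).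
    by move=> _ [t _ <-]; exists (s t); [exists t|exists (u t); [exists t|]].
  by apply: finite_image2; [case: hs|case: hu].
move=> z.
have -> : (fun t => g (s t) (u t)) @^-1` [set z] =
    \bigcup_(x in range s) (s @^-1` [set x] `&` u @^-1` [set y | g x y = z]).
  apply/seteqP; split=> [t /= gz|t [x _ [/= -> //]]].
  by exists (s t); [exists t|].
apply: fin_bigcup_measurable; first by case: hs.
by move=> x _; apply: measurableI; exact: simple_function_preimage.
Qed.

Context (R : realType) (X : normedModType R).
Implicit Types f g : T -> X.

Lemma strongly_measurable_cst (x : X) : strongly_measurable (fun=> x).
Proof.
exists (fun _ _ => x); first by move=> _; exact: simple_function_cst.
by move=> t; exact: cvg_cst.
Qed.

Lemma strongly_measurable_lin (a : R) f g :
  strongly_measurable f -> strongly_measurable g ->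
  strongly_measurable (a *: f + g).
Proof.
move=> [s hs sf] [u hu ug].
exists (fun n t => a *: s n t + u n t).
  by move=> n; exact: (simple_function_comp2 (fun x y : X => a *: x + y)).
by move=> t; apply: cvgD => //; exact: cvgZl_tmp.
Qed.

Lemma strongly_measurable_norm f : strongly_measurable f ->
  measurable_fun [set: T] (fun t => `|f t|).
Proof.
move=> [s hs sf].
apply: (@measurable_fun_cvg _ _ _ _ (fun n t => `|s n t|)).
  move=> n _ B mB; rewrite setTI.
  exact: (simple_function_preimage [set x | B `|x|] (hs n)).
by move=> t _; apply: cvg_norm; exact: sf.
Qed.

End StronglyMeasurable.

(* The Lebesgue-Bochner space [L^q(mu; X)], [1 <= q < oo].                    *)
(* [strongly_measurable] asks for pointwise convergence everywhere: a limit   *)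
(* almost everywhere of simple functions is almost everywhere equal to such a *)
(* function, so the classes are the usual ones, and norms of representatives  *)
(* are measurable even when [mu] is not complete.                             *)
Section Bochner.
Context d (T : measurableType d) (R : realType) (X : normedModType R).
Variables (mu : {measure set T -> \bar R}) (q : R) (q1 : 1 <= q).

Let q_neq0 : q != 0. Proof. by rewrite gt_eqF// (lt_le_trans _ q1). Qed.
Let q_ge0 : 0 <= q. Proof. exact: le_trans q1. Qed.

Definition bochner_norm (f : T -> X) : \bar R :=
  ('N[mu]_q%:E[(fun t => `|f t|%:E)])%E.

(* The proof of [1 <= q] is an argument so that the algebraic instances below *)
(* can be inferred from the type.                                             *)
Definition bochner_function & 1 <= q : {pred T -> X} :=
  mem [set f : T -> X | strongly_measurable f /\ (bochner_norm f < +oo)%E].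

Lemma bochner_functionP f : reflect
  (strongly_measurable f /\ (bochner_norm f < +oo)%E) (f \in bochner_function q1).
Proof. by apply: (iffP idP); rewrite inE. Qed.

Lemma measurable_normr_powR (f : T -> X) : strongly_measurable f ->
  measurable_fun [set: T] (fun t => (`|f t| `^ q)%:E).
Proof.
move=> mf; apply/measurable_EFinP.
apply: (measurableT_comp (measurable_powR _)) => //.
exact: strongly_measurable_norm.
Qed.

Lemma bochner_normE (f : T -> X) :
  bochner_norm f = ((\int[mu]_t (`|f t| `^ q)%:E) `^ q^-1)%E.
Proof.
rewrite /bochner_norm unlock; congr (_ `^ _)%E.
by apply: eq_integral => t _ /=; rewrite normr_id.
Qed.

Lemma bochner_norm_ge0 (f : T -> X) : (0 <= bochner_norm f)%E.
Proof. exact: Lnorm_ge0. Qed.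

Lemma bochner_normZ (a : R) (f : T -> X) : strongly_measurable f ->
  bochner_norm (a *: f) = (`|a|%:E * bochner_norm f)%E.
Proof.
move=> mf; rewrite !bochner_normE.
under eq_integral => t _.
  have -> : `|(a *: f) t| `^ q = `|a| `^ q * `|f t| `^ q.
    by rewrite [(a *: f) t]/= normrZ powRM.
  rewrite EFinM; over.
rewrite ge0_integralZl//; last exact: measurable_normr_powR.
rewrite poweRM ?lee_fin ?powR_ge0 ?integral_ge0//.
by rewrite poweR_EFin -powRrM mulfV// powRr1.
Qed.

Lemma strongly_measurableD (f g : T -> X) :
  strongly_measurable f -> strongly_measurable g -> strongly_measurable (f + g).
Proof. by move=> mf /(strongly_measurable_lin 1 mf); rewrite scale1r. Qed.

Lemma bochner_normD (f g : T -> X) :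
  strongly_measurable f -> strongly_measurable g ->
  (bochner_norm (f + g)%R <= bochner_norm f + bochner_norm g)%E.
Proof.
move=> mf mg.
have nf := strongly_measurable_norm mf.
have ng := strongly_measurable_norm mg.
have mfg := strongly_measurableD mf mg.
apply: le_trans (minkowski_EFin mu nf ng q1).
rewrite bochner_normE unlock; apply: gt0_ler_poweR.
- by rewrite invr_ge0.
- rewrite in_itv/= leey andbT; apply: integral_ge0 => t _.
  by rewrite lee_fin powR_ge0.
- rewrite in_itv/= leey andbT; apply: integral_ge0 => t _.
  by rewrite lee_fin powR_ge0.
apply: ge0_le_integral => //=.
- exact: measurable_normr_powR.
- apply/measurable_EFinP; apply: (measurableT_comp (measurable_powR _)) => //.
  by apply: measurableT_comp => //; exact: measurable_funD.
- move=> t _; rewrite lee_fin ge0_ler_powR ?nnegrE//.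
  by rewrite (le_trans (ler_normD _ _))// ger0_norm.
Qed.

Lemma bochner_norm_eq0 (f : T -> X) : strongly_measurable f ->
  bochner_norm f = 0%E <-> {ae mu, forall t, f t = 0}.
Proof.
move=> mf; have mn := strongly_measurable_norm mf; split.
  move=> /Lnorm_eq0_eq0 H.
  have /measurable_EFinP mn' := mn.
  have := H mn' _; rewrite lte_fin (lt_le_trans _ q1)// => /(_ isT).
  apply: filterS => t /(_ I)/eqP.
  by rewrite eqe normr_eq0 => /eqP.
move=> f0; rewrite bochner_normE.
have fq0 : ae_eq mu [set: T] (fun t => (`|f t| `^ q)%:E) (cst 0%E).
  by apply: filterS f0 => t /= -> _; rewrite normr0 powR0.
rewrite (@ge0_ae_eq_integral _ _ _ mu setT _ (cst 0%E))//; last first.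
  exact: measurable_normr_powR.
by rewrite integral0 poweR0r// invr_neq0.
Qed.

Lemma bochner_function_submod_closed : submod_closed (bochner_function q1).
Proof.
split.
  apply/bochner_functionP; split; first exact: (strongly_measurable_cst _ 0).
  suff -> : bochner_norm 0 = 0%E by [].
  apply/bochner_norm_eq0; first exact: (strongly_measurable_cst _ 0).
  by apply: nearW.
move=> a f g /bochner_functionP[mf Nf] /bochner_functionP[mg Ng].
have maf : strongly_measurable (a *: f).
  have m0 := strongly_measurable_cst T (0 : X).
  by have := strongly_measurable_lin a mf m0; rewrite addr0.
apply/bochner_functionP; split; first exact: strongly_measurable_lin.
apply: (le_lt_trans (bochner_normD maf mg)).
by rewrite lte_add_pinfty// bochner_normZ// lte_mul_pinfty.
Qed.

HB.instance Definition _ :=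
  GRing.isSubmodClosed.Build R (T -> X) (bochner_function q1)
    bochner_function_submod_closed.

Record bochner_fun := BochnerFun {
  bochner_val :> T -> X;
  bochner_valP : bochner_val \in bochner_function q1 }.

HB.instance Definition _ := [isSub for bochner_val].
HB.instance Definition _ := [Choice of bochner_fun by <:].
HB.instance Definition _ := [SubChoice_isSubLmodule of bochner_fun by <:].

Definition bochner_null : {pred bochner_fun} :=
  mem [set f : bochner_fun | {ae mu, forall t, f t = 0}].

Lemma bochner_null_submod_closed : submod_closed bochner_null.
Proof.
split; first by rewrite inE; apply: nearW.
move=> a f g; rewrite !inE => f0 g0.
apply: filterS2 f0 g0 => t /= ft gt.
by rewrite -[LHS]/(a *: f t + g t) ft gt scaler0 addr0.
Qed.

HB.instance Definition _ :=
  GRing.isSubmodClosed.Build R bochner_fun bochner_null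
    bochner_null_submod_closed.

Definition Bochner : Type := Quotient.quot bochner_null.

HB.instance Definition _ := GRing.Zmodule.on Bochner.
HB.instance Definition _ := ZmodQuotient.on Bochner.

Local Open Scope quotient_scope.

Lemma bochner_eqP (f g : bochner_fun) :
  reflect {ae mu, forall t, f t = g t} (f == g %[mod Bochner]).
Proof.
rewrite -Quotient.idealrBE; apply: (iffP idP); rewrite inE.
  apply: filterS => t; rewrite -[X in X = _]/(f t - g t) => /eqP.
  by rewrite subr_eq0 => /eqP.
by apply: filterS => t fg; rewrite -[LHS]/(f t - g t) fg subrr.
Qed.

Definition bochner_scale (a : R) (u : Bochner) : Bochner :=
  \pi_Bochner (a *: repr u).

Lemma bochner_scale_pi a (f : bochner_fun) :
  bochner_scale a (\pi f) = \pi_Bochner (a *: f).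
Proof.
rewrite /bochner_scale; apply/eqP/bochner_eqP.
have /eqP/bochner_eqP : \pi_Bochner (repr (\pi_Bochner f)) = \pi_Bochner f.
  exact: reprK.
by apply: filterS => t /= ft; rewrite -[LHS]/(a *: _) ft.
Qed.

Lemma bochner_scaleA a b u :
  bochner_scale a (bochner_scale b u) = bochner_scale (a * b) u.
Proof.
rewrite -[u]reprK (bochner_scale_pi b) (bochner_scale_pi (a * b)).
by rewrite bochner_scale_pi scalerA.
Qed.

Lemma bochner_scale1 : left_id 1 bochner_scale.
Proof. by move=> u; rewrite -[u]reprK bochner_scale_pi scale1r. Qed.

Lemma bochner_piD (f g : bochner_fun) :
  \pi_Bochner (f + g) = \pi_Bochner f + \pi_Bochner g.
Proof. exact: Quotient.pi_add. Qed.

Lemma bochner_scaleDr : right_distributive bochner_scale +%R.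
Proof.
move=> a u v; rewrite -[u]reprK -[v]reprK -bochner_piD.
by rewrite !(bochner_scale_pi a) scalerDr bochner_piD.
Qed.

Lemma bochner_scaleDl u : {morph bochner_scale^~ u : a b / a + b}.
Proof.
move=> a b; rewrite -[u]reprK (bochner_scale_pi a) (bochner_scale_pi b).
by rewrite (bochner_scale_pi (a + b)) scalerDl bochner_piD.
Qed.

HB.instance Definition _ := GRing.Zmodule_isLmodule.Build R Bochner
  bochner_scaleA bochner_scale1 bochner_scaleDr bochner_scaleDl.

Lemma bochner_piZ a (f : bochner_fun) :
  \pi_Bochner (a *: f) = a *: \pi_Bochner f.
Proof. by rewrite -bochner_scale_pi. Qed.

Lemma bochner_reprP (f : bochner_fun) :
  {ae mu, forall t, repr (\pi_Bochner f) t = f t}.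
Proof. by apply/bochner_eqP/eqP; exact: reprK. Qed.

Lemma eq_bochner_norm (f g : bochner_fun) :
  {ae mu, forall t, f t = g t} -> bochner_norm f = bochner_norm g.
Proof.
have /bochner_functionP[mf _] := bochner_valP f.
have /bochner_functionP[mg _] := bochner_valP g.
move=> fg; rewrite !bochner_normE.
have fgq : ae_eq mu [set: T] (fun t => (`|f t| `^ q)%:E)
    (fun t => (`|g t| `^ q)%:E).
  by apply: filterS fg => t /= -> _.
rewrite (@ge0_ae_eq_integral _ _ _ mu setT _ (fun t => (`|g t| `^ q)%:E))//.
- exact: measurable_normr_powR.
- exact: measurable_normr_powR.
Qed.

Definition bochner_quot_norm (u : Bochner) : R := fine (bochner_norm (repr u)).

Lemma bochner_norm_fin_num (f : bochner_fun) : bochner_norm f \is a fin_num.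
Proof.
have /bochner_functionP[_ Nf] := bochner_valP f.
by rewrite ge0_fin_numE// bochner_norm_ge0.
Qed.

Lemma bochner_quot_norm_pi (f : bochner_fun) :
  bochner_quot_norm (\pi f) = fine (bochner_norm f).
Proof. by congr fine; apply: eq_bochner_norm; exact: bochner_reprP. Qed.

Lemma bochner_quot_normD u v :
  bochner_quot_norm (u + v) <= bochner_quot_norm u + bochner_quot_norm v.
Proof.
rewrite -[u]reprK -[v]reprK -bochner_piD !bochner_quot_norm_pi.
rewrite -fineD ?bochner_norm_fin_num//.
rewrite fine_le ?fin_numD ?bochner_norm_fin_num//.
have /bochner_functionP[mu' _] := bochner_valP (repr u).
have /bochner_functionP[mv' _] := bochner_valP (repr v).
exact: bochner_normD.
Qed.

Lemma bochner_quot_normZ a u :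
  bochner_quot_norm (a *: u) = `|a| * bochner_quot_norm u.
Proof.
rewrite -[u]reprK -bochner_piZ !bochner_quot_norm_pi.
have /bochner_functionP[mu' _] := bochner_valP (repr u).
by rewrite (bochner_normZ _ mu') fineM// bochner_norm_fin_num.
Qed.

Lemma bochner_quot_norm_eq0 u : bochner_quot_norm u = 0 -> u = 0.
Proof.
rewrite /bochner_quot_norm => /eqP.
rewrite -eqe fineK ?bochner_norm_fin_num// => /eqP.
have /bochner_functionP[mu' _] := bochner_valP (repr u).
move=> /(bochner_norm_eq0 mu') u0.
rewrite -[u]reprK; have <- : \pi_Bochner 0 = 0 by exact: pi_zeror.
by apply/eqP/bochner_eqP.
Qed.

HB.instance Definition _ := Lmodule_isNormed.Build R Bochner
  bochner_quot_normD bochner_quot_normZ bochner_quot_norm_eq0.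

Lemma bochner_normrE (f : bochner_fun) :
  `|\pi_Bochner f| = fine (bochner_norm f).
Proof. exact: bochner_quot_norm_pi. Qed.

End Bochner.

(* Functions on [[0, T]] are taken as functions on [R], modulo equality       *)
(* almost everywhere for the restriction of the Lebesgue measure to [[0, T]]. *)
Definition Bochner_interval (R : realType) (X : normedModType R) (q : R)
    (q1 : 1 <= q) (T : R) : normedModType R :=
  Bochner X (mrestr lebesgue_measure (measurable_itv `[0, T])) q1.
Arguments Bochner_interval {R} X {q} q1 T.

(* Main.v *)
(* Dividing the duality mapping by [`|x| `^ (r - 1)] leaves a functional      *)
(* [h x] independent of [r], so the exponents [p] and [q] can be compared     *)
(* pointwise at unit vectors.  For [q <= p] concavity of [u `^ (q / p)] turns *)
(* the [p]-inequality into the [q]-inequality for [`|y| <= 1], a convexity    *)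
(* argument extends it to all [y], and integration concludes.  For [p <= q]   *)
(* the convex power produces an error term [(q / p) * C * `|y| `^ p], valid   *)
(* for [`|y| <= 1] only; tangents to the concave function                     *)
(* [v |-> v `^ (p / q)] at [beta `^ q], [beta <= 1], bound it by              *)
(* [C * ((q - p) / p * beta `^ p + beta `^ (p - q) * `|y| `^ q)] for all [y], *)
(* which can be integrated.  Taking [beta] to be the norm of [y] in [L^q] and *)
(* then the power [p / q] returns the constant [C].                           *)
From HB Require Import structures.
Require Import Defs.
From mathcomp Require Import all_boot all_order all_algebra.
From mathcomp Require Import all_classical all_reals all_analysis.
From mathcomp Require Import measurable_realfun ring lra.

Set Implicit Arguments.
Unset Strict Implicit.
Unset Printing Implicit Defensive.

Import Order.TTheory GRing.Theory Num.Theory.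
Import numFieldNormedType.Exports.

Local Open Scope classical_set_scope.
Local Open Scope ring_scope.

(** A pointwise inequality that is homogeneous of degree [q] integrates to the same inequality for
    the norm of [L^q]. The [p]-inequality of [X] is therefore rewritten with exponent [q], at unit
    vectors and then everywhere by homogeneity. [bochner_norming] integrates it: at the class of [f]
    the functional sends [v] to the integral of [|f|^(q-1) h(f)(v)], divided by the [(q-1)]-th power
    of the norm of [f]; Hoelder bounds it by the norm of [v]. If [q <= p], the rewriting is
    [power_expansion_lower] and the integrated inequality is already the goal. If [p <= q], the
    error in [|y|^p] has the wrong degree; [power_expansion_raise] dominates it by a family of
    admissible bounds indexed by [beta], and after integration [power_expansion_descend] picks
    [beta] and returns to exponent [p]. The constants [K] and [K'] enter through
    [powR_perturbation_le]. The integrand is measurable because the pairing is a limit of difference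
    quotients of [|x|^p] ([measurable_duality_pairing]). *)

Section PowerInequalities.

(** * Convexity inequalities for real powers *)

Variable R : realType.
Implicit Types a b c p q r u v : R.

(** Young's inequality for [c^q] and [1] with exponents [p / q] and [p / (p - q)]; equivalently, the
    concave [v^(q/p)] lies below its tangent at [1]. It is the device for changing exponents in both
    directions. *)
Lemma powR_young p q c : 0 < q <= p -> 0 <= c ->
  p * c `^ q <= q * c `^ p + (p - q).
Proof.
move=> /andP[q0]; rewrite le_eqVlt => /predU1P[<- _|qp c0].
  by rewrite subrr addr0.
have p0 : 0 < p by exact: lt_trans qp.
have pq0 : 0 < p - q by rewrite subr_gt0.
have conj : (p / q)^-1 + (p / (p - q))^-1 = 1.
  by field; rewrite !gt_eqF.
have := conjugate_powR (powR_ge0 c q) ler01 (divr_gt0 p0 q0)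
  (divr_gt0 p0 pq0) conj.
rewrite powR1 mulr1 -powRrM.
have -> : q * (p / q) = p by field; rewrite gt_eqF.
rewrite -(ler_pM2l p0) => h; apply: le_trans h _.
rewrite le_eqVlt; apply/orP; left; apply/eqP.
by field; rewrite !gt_eqF.
Qed.

Lemma bernoulli_powR r c : 1 <= r -> 0 <= c -> r * c <= c `^ r + (r - 1).
Proof.
move=> r1 c0; have := @powR_young r 1 c; rewrite ltr01 r1 => /(_ isT c0).
by rewrite powRr1// mul1r.
Qed.

Lemma ler_powR2r r u v : 0 <= r -> 0 <= u -> u <= v -> u `^ r <= v `^ r.
Proof.
move=> r0 u0 uv; apply: ge0_ler_powR => //; rewrite nnegrE//.
exact: le_trans uv.
Qed.

Lemma convex_combination_powR r t u v : 1 <= r -> 0 <= t <= 1 -> 0 <= u ->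
  0 <= v -> (t * u + (1 - t) * v) `^ r <= t * u `^ r + (1 - t) * v `^ r.
Proof.
move=> r1 /andP[t0 t1] u0 v0.
have := @convex_powR R r r1 (Itv01 t0 t1) u v.
by rewrite !convRE/=; apply; rewrite inE/= in_itv/= andbT.
Qed.

Lemma powR_add_le r u v : 1 <= r -> 0 <= u -> 0 <= v ->
  (u + v) `^ r <= 2 `^ (r - 1) * (u `^ r + v `^ r).
Proof.
move=> r1 u0 v0.
have r0 : 0 < r by rewrite (lt_le_trans ltr01).
have := @convex_combination_powR r 2^-1 u v r1 _ u0 v0.
have -> : 1 - 2^-1 = 2^-1 :> R by lra.
rewrite -!mulrDr powRM ?addr_ge0//.
have -> : (2^-1 : R) `^ r = (2 `^ r)^-1.
  by rewrite -powR_inv1// -powRAC powR_inv1// powR_ge0.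
have -> : 0 <= (2^-1 : R) <= 1 by apply/andP; split; lra.
move=> /(_ isT).
have p2 : 0 < 2 `^ r :> R by exact: powR_gt0.
rewrite -(ler_pM2l p2) mulVKf ?gt_eqF// => /le_trans; apply.
by rewrite -(@mulr_powRB1 _ 2 r)// mulrA [2 * _]mulrC mulfK.
Qed.

(* Past [b = 1] the left-hand side grows at most like [(1 + b)^r], because    *)
(* [c <= 2] and [u |-> u^r] is convex.                                        *)
Lemma extension_powR r C C0 c sigma b : 1 <= r -> 0 <= c <= 2 -> sigma <= 1 ->
  1 <= b -> 2 `^ r <= C -> c `^ r <= 1 - r * sigma + C0 ->
  (c + (b - 1)) `^ r <= 1 - r * (b * sigma) + C0 + C * (b `^ r - 1).
Proof.
move=> r1 /andP[c0 c2] s1 b1 C2 h.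
have r0 : 0 < r by rewrite (lt_le_trans ltr01).
have b0 : 0 <= b by rewrite (le_trans ler01).
have incr : (c + (b - 1)) `^ r + 2 `^ r <= c `^ r + (1 + b) `^ r.
  have [dn0|dn0] := eqVneq (1 + b - c) 0.
    have bE : b = 1 by lra.
    have cE : c = 2 by lra.
    by rewrite bE cE subrr addr0.
  have d0 : 0 < 1 + b - c by rewrite lt_neqAle eq_sym dn0/=; lra.
  (* [c + (b - 1)] and [2] are convex combinations of the endpoints [c] and [1 + b] with swapped
     weights, so adding the two convexity inequalities gives [incr]. *)
  pose t := (2 - c) / (1 + b - c).
  have t01 : 0 <= t <= 1.
    apply/andP; split; first by rewrite divr_ge0 ?(ltW d0)// subr_ge0.
    by rewrite /t ler_pdivrMr// mul1r; lra.
  have t01' : 0 <= 1 - t <= 1.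
      by move/andP: t01 => [? ?]; apply/andP; split; lra.
  have td : t * (1 + b - c) = 2 - c by rewrite divfK// gt_eqF.
  have b10 : 0 <= 1 + b by lra.
  have := lerD (convex_combination_powR r1 t01 c0 b10)
     (convex_combination_powR r1 t01' c0 b10).
  have -> : t * c + (1 - t) * (1 + b) = c + (b - 1) by lra.
  have -> : (1 - t) * c + (1 - (1 - t)) * (1 + b) = 2 by lra.
  set U := c `^ r; set V := (1 + b) `^ r => h2.
  by rewrite (le_trans h2)// le_eqVlt; apply/orP; left; apply/eqP; ring.
have := powR_add_le r1 ler01 b0; rewrite powR1 => pm.
have := bernoulli_powR r1 b0 => be.
have two : 2 * 2 `^ (r - 1) = 2 `^ r :> R by rewrite mulr_powRB1.
have br1 : 1 <= b `^ r by rewrite -[leLHS](powRr0 b) ler_powR// ltW.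
have one : 1 <= 2 `^ (r - 1) :> R.
  by rewrite -[leLHS](powRr0 2) ler_powR ?ler1n ?subr_ge0.
(* What remains is [r (b - 1) sigma + 2^(r-1) (b^r - 1) <= C (b^r - 1)]: the first term is at most
   [b^r - 1] by Bernoulli, and [1 + 2^(r-1) <= 2^r <= C]. *)
have : r * (b - 1) * (1 - sigma) >= 0.
  by rewrite !mulr_ge0 ?subr_ge0// ltW.
have : (2 `^ (r - 1) - 1) * (b `^ r - 1) >= 0.
  by rewrite !mulr_ge0 ?subr_ge0.
have : (C - 2 `^ r) * (b `^ r - 1) >= 0.
  by rewrite !mulr_ge0 ?subr_ge0.
rewrite -two in incr *; lra.
Qed.

End PowerInequalities.

(** * Lipschitz constants of powers on [[1/2, 1]] *)

Section LipschitzConstant.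
Variable R : realType.
Implicit Types (A : set R) (f : R -> R) (e k x y : R).

Lemma lipschitz_constant_ge0 A f : 0 <= lipschitz_constant A f.
Proof.
rewrite /lipschitz_constant; set S := [set k | _].
have [->|/set0P S0] := eqVneq S set0; first by rewrite inf0.
by apply: lb_le_inf => // k [].
Qed.

(** The bound [k] makes the set of admissible constants nonempty; otherwise its infimum would be the
    default value [0]. *)
Lemma lipschitz_constantP A f k :
    0 <= k -> (forall x y, A x -> A y -> `|f x - f y| <= k * `|x - y|) ->
  forall x y, A x -> A y -> `|f x - f y| <= lipschitz_constant A f * `|x - y|.
Proof.
move=> k0 kf x y Ax Ay.
have [->|xy] := eqVneq x y; first by rewrite !subrr normr0 mulr0.
have xy0 : 0 < `|x - y| by rewrite normr_gt0 subr_eq0.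
rewrite -ler_pdivrMr//; apply: lb_le_inf => [|m [_ mf]].
  by exists k; split => // -[u v] [/= Au Av]; exact: kf.
by rewrite ler_pdivrMr//; exact: (mf (x, y)).
Qed.

Lemma powR_lipschitz_constant e x y :
  2^-1 <= x <= 1 -> 2^-1 <= y <= 1 ->
  `|x `^ e - y `^ e| <=
    lipschitz_constant `[2^-1, 1] (fun h : R => h `^ e) * `|x - y|.
Proof.
move=> xI yI.
(* A bound on [[1/2, 1]] for the derivative [e * z^(e-1)], for use with the mean value theorem. *)
pose k := `|e| * 2 `^ `|e - 1|.
have k0 : 0 <= k by rewrite mulr_ge0 ?powR_ge0.
have half0 : 0 < 2^-1 :> R by rewrite invr_gt0.
have := @lipschitz_constantP `[2^-1, 1] (fun h : R => h `^ e) k k0.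
apply; last 2 first.
- by rewrite /= in_itv.
- by rewrite /= in_itv.
move=> {xI yI} u v /=; rewrite !in_itv/=.
wlog uv : u v / u <= v => [hwlog|].
  have [/hwlog|/ltW /hwlog] := leP u v; first exact.
  by move=> vu uI vI; rewrite distrC (distrC u); exact: vu.
move=> /andP[u1 _] /andP[_ v1].
have pos z : u <= z -> 0 < z.
  by move=> uz; rewrite (lt_le_trans half0)// (le_trans u1).
have dpow z : z \in `]u, v[ -> is_derive z 1 (@powR R ^~ e) (e * z `^ (e - 1)).
  rewrite in_itv/= => /andP[uz _].
  by apply: is_derive1_powR; exact: pos (ltW uz).
have cpow : {within `[u, v], continuous (@powR R ^~ e)}.
  apply: derivable_within_continuous => z; rewrite in_itv/= => /andP[uz _].
  by apply: derivable_powR; rewrite in_itv/= andbT pos.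
have [z] := MVT_segment uv dpow cpow.
rewrite in_itv/= => /andP[uz zv] uvE.
have z0 := pos _ uz.
rewrite distrC uvE normrM (distrC v u) ler_wpM2r//.
rewrite normrM /k ler_wpM2l// ger0_norm ?powR_ge0//.
apply: (@le_trans _ _ (z `^ (- `|e - 1|))).
  apply: ger_powR; first by rewrite z0 (le_trans zv).
  by rewrite lerNl -normrN ler_norm.
rewrite -[- `|_|]mulN1r powRrM powR_inv1 ?(ltW z0)//.
apply: ler_powR2r; rewrite ?normr_ge0 ?invr_ge0 ?(ltW z0)//.
by rewrite -[leRHS]invrK lef_pV2 ?posrE ?(le_trans u1).
Qed.

End LipschitzConstant.

(** * Raising the exponent of the expansion from [p] to [q], for scalars *)

Section PointwiseExpansion.
Variable R : realType.
Implicit Types p q b c s G : R.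

(** With [mul_le_powR], this converts the errors met on either side of [b = 1/2] into multiples of
    [b^p]: here [b^(2-p)] is largest at [b = 1/2], there [2 b >= 1] gives [2 b <= (2 b)^p]. *)
Lemma sqr_le_powR p b : p <= 2 -> 0 <= b <= 2^-1 ->
  b * b <= 2 `^ (p - 2) * b `^ p.
Proof.
move=> p2 /andP[]; rewrite le_eqVlt => /predU1P[<- _|b0 bh].
  by rewrite mulr0 mulr_ge0 ?powR_ge0.
have b2 : b * b = b `^ (2 - p) * b `^ p.
  rewrite -powRD; last by rewrite (gt_eqF b0) implybT.
  by rewrite subrK (powR_mulrn 2 (ltW b0)) expr2.
rewrite b2 ler_wpM2r ?powR_ge0//.
apply: (@le_trans _ _ (2^-1 `^ (2 - p))).
  by apply: ler_powR2r; rewrite ?subr_ge0 ?(ltW b0).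
rewrite -(powR_inv1 (ler0n R 2)) -powRrM.
by rewrite (_ : -1 * (2 - p) = p - 2)//; ring.
Qed.

Lemma mul_le_powR p b : 1 <= p <= 2 -> 2^-1 <= b ->
  p * b <= 2 `^ p * b `^ p.
Proof.
move=> /andP[p1 p2] bh.
have b0 : 0 <= b by lra.
rewrite -powRM//; apply: (@le_trans _ _ (2 * b)); first by rewrite ler_wpM2r.
by apply: le1r_powR => //; lra.
Qed.

Section Constants.
Variables p q G K K' C : R.
Hypotheses (p12 : 1 < p <= 2) (pq : p <= q) (G0 : 0 < G).
Hypotheses (K_ge0 : 0 <= K) (K'_ge0 : 0 <= K').
Hypothesis lipK : forall h, 2^-1 <= h <= 1 -> 1 - h `^ (q - p) <= K * (1 - h).
Hypothesis lipK' : forall h, 2^-1 <= h <= 1 -> h `^ (p - q) - 1 <= K' * (1 - h).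
Hypothesis C_ge_pow : 2 `^ q <= C.
Hypothesis C_ge :
  2 `^ (q - p) * G + K * 2 `^ (q - 2) + K' * 2 `^ (p - 2) <= C.

Let powqp : 2 `^ (q - p) * 2 `^ (p - 2) = 2 `^ (q - 2) :> R.
Proof. by rewrite -powRD ?pnatr_eq0 ?implybT// addrA subrK. Qed.

Let pow4 r : 2 `^ r = 4 * 2 `^ (r - 2) :> R.
Proof.
rewrite powRB ?pnatr_eq0 ?implybT// (@powR_mulrn _ 2 2)// -natrX.
by rewrite mulrC divfK// pnatr_eq0.
Qed.

(** The left-hand side is the error left when the [p]-inequality is multiplied by [c^(q-p)] and its
    linear term is put back to [s]; in use [c = |e - y|], [s = h y] and [b = |y|]. Since [c] is
    within [b] of [1], the Lipschitz bounds at [h = c], or at [h = 1/c] when [c >= 1], control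
    [1 - c^(q-p)] for [b <= 1/2]. *)
Lemma powR_perturbation_le b c s : 0 <= b <= 1 -> 0 <= c -> `|c - 1| <= b ->
  `|s| <= b ->
  c `^ (q - p) * (G * b `^ p) + p * ((1 - c `^ (q - p)) * s) <= C * b `^ p.
Proof.
move: p12 => /andP[p1 p2] /andP[b0 b1] c0 /ler_normlP[c1b c1b'] sb.
have p0 : 0 < p by rewrite (lt_trans ltr01).
have d0 : 0 <= q - p by rewrite subr_ge0.
set L := c `^ (q - p); set B := b `^ p.
have B0 : 0 <= B by exact: powR_ge0.
have GB0 : 0 <= G * B by rewrite mulr_ge0// ltW.
have p_ge1 : 1 <= p <= 2 by rewrite ltW.
have sL : p * ((1 - L) * s) <= `|1 - L| * (p * b).
  rewrite mulrCA; apply: (le_trans (ler_norm _)).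
  by rewrite !normrM ler_wpM2l// (gtr0_norm p0) ler_wpM2l// ltW.
apply: (@le_trans _ _ (L * (G * B) + `|1 - L| * (p * b))).
  by rewrite lerD2l.
set D := 2 `^ (q - p) : R.
have D1 : 1 <= D by rewrite /D -[leLHS](powRr0 2) ler_powR ?ler1n.
have Q1 : 0 <= 2 `^ (p - 2) :> R by exact: powR_ge0.
have Cge : (D * G + K * (D * 2 `^ (p - 2)) + K' * 2 `^ (p - 2)) * B <= C * B.
  by rewrite ler_wpM2r// /D powqp.
have K1 : 0 <= K * 2 `^ (p - 2) by rewrite mulr_ge0.
have K'1 : 0 <= K' * 2 `^ (p - 2) by rewrite mulr_ge0.
have [c1|c1] := leP 1 c.
  have cp : 0 < c by rewrite (lt_le_trans ltr01).
  have L1 : 1 <= L by rewrite /L -(powRr0 c) ler_powR.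
  have LD : L <= D by apply: ler_powR2r => //; lra.
  have LGB : L * (G * B) <= D * (G * B) by rewrite ler_wpM2r.
  rewrite distrC ger0_norm ?subr_ge0//.
  apply: le_trans Cge.
  have [bh|bh] := leP b 2^-1.
    have b2 : b * b <= 2 `^ (p - 2) * B by apply: sqr_le_powR => //; rewrite b0.
    have ci : 2^-1 <= c^-1 <= 1.
      by rewrite invf_le1// c1 lef_pV2 ?posrE//; lra.
    have ci1 : 1 - c^-1 <= b.
      rewrite -(ler_pM2r cp) mulrBl mul1r mulVf ?gt_eqF//.
      have : 0 <= b * (c - 1) by rewrite mulr_ge0// subr_ge0.
      lra.
    have L1K' : L - 1 <= K' * b.
      have := lipK' ci; rewrite -(powR_inv1 c0) -powRrM mulN1r opprB.
      rewrite (powR_inv1 c0) => /le_trans; apply.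
      by rewrite ler_wpM2l.
    have L1K : L - 1 <= D * (K * b).
      have := lipK ci; rewrite -(powR_inv1 c0) -powRrM mulN1r powRN -/L.
      rewrite (powR_inv1 c0) => h.
      have -> : L - 1 = L * (1 - L^-1).
        by field; rewrite gt_eqF// (lt_le_trans ltr01).
      apply: ler_pM => //; first by rewrite (le_trans ler01).
        by rewrite subr_ge0 invf_le1// (lt_le_trans ltr01).
      by apply: (le_trans h); rewrite ler_wpM2l.
    (* As [p <= 2], at most two copies of [L - 1] occur: one is estimated with [K'], the other with
       [K]. *)
    have pb : (L - 1) * (p * b) <= (K' + D * K) * (b * b).
      have : (L - 1) * (p * b) <= (L - 1) * (2 * b).
        by rewrite ler_wpM2l ?subr_ge0// ler_wpM2r.
      have := ler_wpM2r b0 L1K'; have := ler_wpM2r b0 L1K; lra.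
    have DK : 0 <= K' + D * K.
      by rewrite addr_ge0// mulr_ge0// (le_trans ler01).
    have := ler_wpM2l DK b2; lra.
  have pb := mul_le_powR p_ge1 (ltW bh).
  (* Now [1/c] may be out of reach of the bounds on [b], but [c <= 2] gives [L <= D], and [D - 1] is
     estimated by both Lipschitz bounds at [h = 1/2]. *)
  have half : 2^-1 <= (2^-1 : R) <= 1 by apply/andP; split; lra.
  have DV : 2^-1 `^ (q - p) = D^-1.
    by rewrite -(powR_inv1 (ler0n R 2)) -powRrM mulN1r powRN.
  have DV' : 2^-1 `^ (p - q) = D.
    by rewrite -(powR_inv1 (ler0n R 2)) -powRrM mulN1r opprB.
  have DK' := lipK' half; rewrite DV' in DK'.
  have DK := lipK half; rewrite DV in DK.
  have {}DK : D - 1 <= D * (K * (1 - 2^-1)).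
    have -> : D - 1 = D * (1 - D^-1).
      by field; rewrite gt_eqF// (lt_le_trans ltr01).
    by rewrite ler_wpM2l// (le_trans ler01).
  have P0 : 0 <= 4 * 2 `^ (p - 2) * B by rewrite !mulr_ge0.
  rewrite (pow4 p) -/B in pb.
  have : (L - 1) * (p * b) <= (D - 1) * (4 * 2 `^ (p - 2) * B).
    apply: ler_pM => //; rewrite ?subr_ge0// ?mulr_ge0// ?(ltW p0)//.
    by rewrite lerD2r.
  have := ler_wpM2r P0 DK'; have := ler_wpM2r P0 DK; lra.
have L1 : L <= 1.
  by have := ler_powR2r d0 c0 (ltW c1); rewrite powR1.
have L0 : 0 <= L by exact: powR_ge0.
have GD : G * B <= D * G * B.
  by rewrite -mulrA ler_peMl.
rewrite ger0_norm ?subr_ge0//.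
have [bh|bh] := leP b 2^-1.
  have b2 : b * b <= 2 `^ (p - 2) * B by apply: sqr_le_powR => //; rewrite b0.
  have ci : 2^-1 <= c <= 1 by apply/andP; split; lra.
  have cp : 0 < c by lra.
  have Lp : 0 < L by rewrite powR_gt0.
  have c1' : 1 - c <= b by lra.
  have L1K : 1 - L <= K * b.
    by apply: (le_trans (lipK ci)); rewrite ler_wpM2l.
  have L1K' : 1 - L <= K' * b.
    have := lipK' ci; rewrite -[p - q]opprB powRN -/L => h.
    apply: (@le_trans _ _ (L^-1 - 1)).
      have -> : 1 - L = L * (L^-1 - 1) by field; rewrite gt_eqF.
      by rewrite ler_piMl// subr_ge0 invf_ge1.
    by apply: (le_trans h); rewrite ler_wpM2l.
  have pb : (1 - L) * (p * b) <= (K + K') * (b * b).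
    have : (1 - L) * (p * b) <= (1 - L) * (2 * b).
      by rewrite ler_wpM2l ?subr_ge0// ler_wpM2r.
    have := ler_wpM2r b0 L1K'; have := ler_wpM2r b0 L1K; lra.
  have KK : 0 <= K + K' by rewrite addr_ge0.
  have hKK := ler_wpM2l KK b2.
  have LGB : L * (G * B) <= G * B by rewrite ler_piMl.
  have KB : K * 2 `^ (p - 2) * B <= D * (K * 2 `^ (p - 2) * B).
    by rewrite ler_peMl// mulr_ge0.
  apply: le_trans Cge; lra.
(* The quantity to bound is an average, with weights [L] and [1 - L], of [G * B] and [p * b], each
   at most [C * B]. *)
have pb := mul_le_powR p_ge1 (ltW bh).
have GC : G * B <= C * B.
  apply: le_trans Cge; apply: (le_trans GD).
  rewrite ler_wpM2r// -addrA lerDl addr_ge0//.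
  by rewrite mulrCA mulr_ge0// (le_trans ler01).
have PC : p * b <= C * B.
  apply: (le_trans pb); rewrite ler_wpM2r//.
  by apply: le_trans C_ge_pow; rewrite ler_powR ?ler1n.
have L1' : 0 <= 1 - L by rewrite subr_ge0.
have := ler_wpM2l L0 GC; have := ler_wpM2l L1' PC; lra.
Qed.

(** Multiply the hypothesis by [L = c^(q-p)]. Young's inequality [q L <= (q - p) c^q + p] removes
    [L] from the constant term, the part in [c^q] being absorbed on the left, and
    [powR_perturbation_le] bounds the rest. *)
Lemma powR_expansion_le b c s : 0 <= b <= 1 -> 0 <= c -> `|c - 1| <= b ->
  `|s| <= b -> c `^ p <= 1 - p * s + G * b `^ p ->
  c `^ q <= 1 - q * s + q / p * (C * b `^ p).
Proof.
move=> bI c0 cb sb h; have := powR_perturbation_le bI c0 cb sb.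
move: p12 => /andP[p1 p2].
have p0 : 0 < p by rewrite (lt_trans ltr01).
have q0 : 0 < q by rewrite (lt_le_trans p0).
set L := c `^ (q - p) => hE.
have L0 : 0 <= L by exact: powR_ge0.
have cqE : c `^ q = L * c `^ p.
  have [->|cn0] := eqVneq c 0.
    by rewrite !powR0 ?gt_eqF ?mulr0.
  by rewrite /L -powRD ?subrK// cn0 implybT.
have young : q * L <= (q - p) * c `^ q + p.
  move: pq; rewrite le_eqVlt => /predU1P[pqE|plq].
    by rewrite /L -pqE subrr powRr0 mul0r add0r mulr1.
  have := @powR_young R q (q - p) c _ c0.
  rewrite subr_gt0 plq lerBlDr lerDl (ltW p0) => /(_ isT).
  by rewrite subKr.
rewrite -(ler_pM2l p0).
have -> : p * (1 - q * s + q / p * (C * b `^ p)) =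
    p - p * q * s + q * (C * b `^ p) by field; rewrite gt_eqF.
have := ler_wpM2l (ltW q0) hE.
have := ler_wpM2l (mulr_ge0 (ltW q0) L0) h.
rewrite cqE in young *; lra.
Qed.

End Constants.

Definition smoothness_constant p q G :=
  let K := lipschitz_constant `[2^-1, 1] (fun h : R => h `^ (q - p)) in
  let K' := lipschitz_constant `[2^-1, 1] (fun h : R => h `^ (p - q)) in
  Num.max (2 `^ q) (2 `^ (q - p) * G + K * 2 `^ (q - 2)) + K' * 2 `^ (p - 2).

Section SmoothnessConstant.
Variables p q G : R.

Lemma smoothness_constant_ge : 2 `^ q <= smoothness_constant p q G.
Proof.
by apply: ler_wpDr; rewrite ?le_max ?lexx// mulr_ge0 ?powR_ge0//
  lipschitz_constant_ge0.
Qed.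

Lemma smoothness_constant_expansion b c s :
  1 < p <= 2 -> p <= q -> 0 < G ->
  0 <= b <= 1 -> 0 <= c -> `|c - 1| <= b -> `|s| <= b ->
  c `^ p <= 1 - p * s + G * b `^ p ->
  c `^ q <= 1 - q * s + q / p * (smoothness_constant p q G * b `^ p).
Proof.
move=> p12 pq G0.
apply: (@powR_expansion_le p q G
  (lipschitz_constant `[2^-1, 1] (fun h : R => h `^ (q - p)))
  (lipschitz_constant `[2^-1, 1] (fun h : R => h `^ (p - q)))) => //.
- exact: lipschitz_constant_ge0.
- exact: lipschitz_constant_ge0.
- move=> h hI; have := @powR_lipschitz_constant R (q - p) 1 h _ hI.
  have -> : 2^-1 <= (1 : R) <= 1 by apply/andP; split; lra.
  rewrite powR1 => /(_ isT); move/andP: hI => [_ h1].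
  by rewrite (@ger0_norm _ (1 - h)) ?subr_ge0// => /(le_trans (ler_norm _)).
- move=> h hI; have := @powR_lipschitz_constant R (p - q) h 1 hI.
  have -> : 2^-1 <= (1 : R) <= 1 by apply/andP; split; lra.
  rewrite powR1 => /(_ isT); move/andP: hI => [_ h1].
  rewrite (distrC h 1) (@ger0_norm _ (1 - h)) ?subr_ge0//.
  exact/le_trans/ler_norm.
- exact: smoothness_constant_ge.
- by rewrite lerD2r le_max lexx orbT.
Qed.

End SmoothnessConstant.

End PointwiseExpansion.

(** * Normalised duality functionals and power expansions in a normed space *)

Section Norming.
Variables (R : realType) (Z : normedModType R).
Implicit Types (x y e : Z) (h : {linear Z -> R^o}) (p q r t A B C G : R).

(* The element [`|x| `^ (r - 1) *: h] of the duality mapping, normalised so   *)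
(* as not to depend on [r].                                                   *)
Definition norming x h : Prop := (forall y, `|h y| <= `|y|) /\ h x = `|x|.

(** The defect [A] holds the constant term of the tangent lines used when [p <= q]; attached to
    [|x|^q], it keeps the inequality homogeneous and hence integrable. *)
Definition power_expansion q A B x h : Prop := forall y,
  `|x - y| `^ q <=
    (1 + A) * `|x| `^ q - q * `|x| `^ (q - 1) * h y + B * `|y| `^ q.

Lemma norming_duality_map r x h : 1 < r -> norming x h ->
  duality_map r x (`|x| `^ (r - 1) \*: h).
Proof.
move=> r1 [hy hx]; set a := `|x| `^ (r - 1).
have a0 : 0 <= a by exact: powR_ge0.
have bnd y : `|(a \*: h) y| <= a * `|y|.
  by rewrite /= normrZ ger0_norm// ler_wpM2l.
have dE : dual_norm (a \*: h) = a.
  rewrite /dual_norm; set S := [set _ | _ in _].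
  have Sa : ubound S a.
    move=> _ [y /= y1 <-]; apply: (le_trans (bnd y)).
    by rewrite ler_piMr.
  apply/eqP; rewrite eq_le; apply/andP; split.
    apply: ge_sup => //; exists `|(a \*: h) 0|, 0 => //=.
    by rewrite normr0.
  apply: ub_le_sup; first by exists a.
  have [x0|x0] := eqVneq x 0.
    exists 0; first by rewrite /= normr0.
    by rewrite linear0 normr0 /a x0 normr0 powR0// gt_eqF// subr_gt0.
  exists (`|x|^-1 *: x).
    by rewrite /= normrZ normfV normr_id mulVf// normr_eq0.
  rewrite linearZ /= hx normrZ normfV normr_id normrZ normr_id ger0_norm//.
  by rewrite mulrCA mulVf ?mulr1// normr_eq0.
split; last 2 first.
- by rewrite dE /= hx mulrC.
- by [].
apply: bounded_linear_continuous; apply/linear_boundedP.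
near=> M => y; apply: (le_trans (bnd y)); rewrite ler_wpM2r//.
Unshelve. all: by end_near. Qed.

Lemma duality_map_norming r x (f : {linear Z -> R^o}) : 1 < r ->
  duality_map r x f ->
  norming x (`|x| `^ (1 - r) \*: f) /\
  forall y, f y = `|x| `^ (r - 1) * (`|x| `^ (1 - r) *: f y).
Proof.
move=> r1 [cf fx nf].
have f_le y : `|f y| <= `|x| `^ (r - 1) * `|y|.
  by rewrite -nf; exact: dual_norm_ub.
have r0 : r - 1 != 0 by rewrite gt_eqF// subr_gt0.
have [x0|x0] := eqVneq x 0.
  have f0 y : f y = 0.
    apply/eqP; rewrite -normr_le0; apply: (le_trans (f_le y)).
    by rewrite x0 normr0 powR0// mul0r.
  by split=> [|y]; [split=> [y|] |];
    rewrite /= f0 scaler0 ?mulr0// ?normr0// x0 normr0.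
have xp : 0 < `|x| by rewrite normr_gt0.
have inv : `|x| `^ (1 - r) * `|x| `^ (r - 1) = 1.
  by rewrite -powRD ?(gt_eqF xp) ?implybT// subrKA subrr powRr0.
split=> [|y]; last by rewrite /GRing.scale /= mulrA [X in X * _]mulrC inv mul1r.
split=> [y|]; rewrite /=.
  rewrite normrZ ger0_norm ?powR_ge0//.
  have := ler_wpM2l (powR_ge0 `|x| (1 - r)) (f_le y).
  by rewrite mulrA inv mul1r.
by rewrite fx nf /GRing.scale /= mulrCA inv mulr1.
Qed.

Lemma power_smoothP r G : 1 < r -> power_smooth Z r G <->
  0 < G /\ exists h : Z -> {linear Z -> R^o},
    forall x, norming x (h x) /\ power_expansion r 0 G x (h x).
Proof.
move=> r1; split=> -[G0].
  move=> [j jd jG]; split => //.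
  exists (fun x => `|x| `^ (1 - r) \*: j x) => x.
  have [nj jE] := duality_map_norming r1 (jd x).
  split=> // y; apply: (le_trans (jG x y)).
  by rewrite addr0 mul1r (jE y) mulrA.
move=> [h hP]; split => //.
exists (fun x => `|x| `^ (r - 1) \*: h x) => [x|x y].
  by apply: norming_duality_map => //; have [] := hP x.
have [_ /(_ y)] := hP x.
by rewrite addr0 mul1r -mulrA.
Qed.

Lemma norming_scale t x h : 0 < t -> norming x h -> norming (t *: x) h.
Proof.
move=> t0 [hy hx]; split=> //.
by rewrite linearZ /= hx normrZ gtr0_norm.
Qed.

Lemma power_expansion_scale t q A B x h : 0 < t ->
  power_expansion q A B x h -> power_expansion q A B (t *: x) h.
Proof.
move=> t0 hx y.
have tn : t != 0 by rewrite gt_eqF.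
have -> : y = t *: (t^-1 *: y) by rewrite scalerA divff// scale1r.
move: (t^-1 *: y) => z; have hz : h (t *: z) = t * h z by rewrite linearZ.
rewrite -scalerBr !normrZ (gtr0_norm t0) !powRM// ?(ltW t0)// hz.
have tq : t `^ (q - 1) * t = t `^ q.
  by rewrite -{2}(powRr1 (ltW t0)) -powRD ?subrK// tn implybT.
have := ler_wpM2l (powR_ge0 t q) (hx z); rewrite -tq; lra.
Qed.

Lemma power_expansion0 q A B h : 1 < q -> 1 <= B -> power_expansion q A B 0 h.
Proof.
move=> q1 B1 y; rewrite sub0r normrN normr0 !powR0; first last.
- by rewrite gt_eqF// (lt_trans ltr01).
- by rewrite gt_eqF// subr_gt0.
by rewrite !mulr0 mul0r subr0 add0r ler_peMl ?powR_ge0.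
Qed.

Lemma unit_norming x h : x != 0 -> norming x h ->
  `|(`|x|^-1 *: x)| = 1 /\ norming (`|x|^-1 *: x) h.
Proof.
move=> x0 nh; split; first by rewrite normrZ normfV normr_id mulVf ?normr_eq0.
by apply: norming_scale => //; rewrite invr_gt0 normr_gt0.
Qed.

Lemma power_expansion_unit q A B x h : x != 0 ->
  power_expansion q A B (`|x|^-1 *: x) h <-> power_expansion q A B x h.
Proof.
move=> x0; have xp : 0 < `|x| by rewrite normr_gt0.
split=> hx; last by apply: power_expansion_scale; rewrite ?invr_gt0.
have := power_expansion_scale xp hx.
by rewrite scalerA divff ?scale1r// gt_eqF.
Qed.

Section Unit.
Variables (e : Z) (h : {linear Z -> R^o}).
Hypotheses (e1 : `|e| = 1) (neh : norming e h).

Lemma power_expansion1 q A B :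
  (forall y, `|e - y| `^ q <= 1 + A - q * h y + B * `|y| `^ q) <->
  power_expansion q A B e h.
Proof. by split=> hy y; have := hy y; rewrite !e1 !powR1 !mulr1. Qed.

Lemma power_expansion_extend r C0 C : 1 <= r -> 2 `^ r <= C ->
  (forall y, `|y| = 1 -> `|e - y| `^ r <= 1 - r * h y + C0) ->
  forall y, 1 <= `|y| ->
    `|e - y| `^ r <= 1 - r * h y + C0 + C * (`|y| `^ r - 1).
Proof.
move=> r1 C2 hr y y1; have [hle _] := neh.
have y0 : 0 < `|y| by rewrite (lt_le_trans ltr01).
have yn : `|y| != 0 by rewrite gt_eqF.
pose u := `|y|^-1 *: y.
have u1 : `|u| = 1 by rewrite normrZ normfV normr_id mulVf.
have yE : y = `|y| *: u by rewrite scalerA divff// scale1r.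
have hyE : h y = `|y| * h u by rewrite {1}yE linearZ.
have hu1 : h u <= 1 by rewrite -u1 (le_trans (ler_norm _)).
have eu2 : 0 <= `|e - u| <= 2.
  by rewrite normr_ge0 (le_trans (ler_normB _ _))// e1 u1; lra.
have := extension_powR r1 eu2 hu1 y1 C2 (hr u u1).
rewrite hyE; apply: le_trans.
apply: ler_powR2r; [by lra|exact: normr_ge0|].
have -> : e - y = (e - u) + (u - y) by rewrite addrA subrK.
apply: (le_trans (ler_normD _ _)); rewrite lerD2l.
have -> : u - y = (1 - `|y|) *: u by rewrite scalerBl scale1r -yE.
by rewrite normrZ u1 mulr1 ler0_norm ?opprB// subr_le0.
Qed.

Lemma power_expansion_lower p q C G : 1 < q <= p -> 0 < G -> G <= C ->
  2 `^ q <= C -> power_expansion p 0 G e h -> power_expansion q 0 C e h.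
Proof.
move=> /andP[q1 qp] G0 GC C2 /power_expansion1 hp; apply/power_expansion1.
have q0 : 0 < q by rewrite (lt_trans ltr01).
have p0 : 0 < p by rewrite (lt_le_trans q0).
have small y : `|y| <= 1 -> `|e - y| `^ q <= 1 + 0 - q * h y + C * `|y| `^ q.
  move=> y1; rewrite addr0.
  have qpI : 0 < q <= p by rewrite q0.
  have yo := powR_young qpI (normr_ge0 (e - y)).
  have hy := hp y; rewrite addr0 in hy.
  have bpq : `|y| `^ p <= `|y| `^ q.
    have [->|yn] := eqVneq y 0; first by rewrite normr0 !powR0// gt_eqF.
    by apply: ger_powR => //; rewrite normr_gt0 yn.
  have GB : G * `|y| `^ p <= C * `|y| `^ q.
    by apply: ler_pM; rewrite ?powR_ge0// ltW.
  have CB : 0 <= C * `|y| `^ q.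
    by rewrite mulr_ge0 ?powR_ge0// (le_trans (ltW G0)).
  rewrite -(ler_pM2l p0).
  have := ler_wpM2l (ltW q0) hy.
  have := ler_wpM2l (ltW q0) GB.
  have := ler_wpM2r CB qp.
  lra.
move=> y; have [y1|y1] := leP `|y| 1; first exact: small.
have := @power_expansion_extend q C C (ltW q1) C2 _ y (ltW y1).
rewrite addr0 => /(_ _)/le_trans; apply; last by lra.
by move=> z z1; have := small z; rewrite z1 lexx powR1 mulr1 addr0; apply.
Qed.

Lemma power_expansion_raise p q G beta : 1 < p <= 2 -> p <= q -> 0 < G ->
  0 < beta <= 1 -> power_expansion p 0 G e h ->
  power_expansion q ((q - p) / p * smoothness_constant p q G * beta `^ p)
    (smoothness_constant p q G * beta `^ (p - q)) e h.
Proof.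
move=> p12 pq G0 /andP[b0 b1] /power_expansion1 hp; apply/power_expansion1.
move/andP: (p12) => [p1 p2].
have p0 : 0 < p by rewrite (lt_trans ltr01).
have q0 : 0 < q by rewrite (lt_le_trans p0).
have C2 := smoothness_constant_ge p q G.
have [hle _] := neh.
have he := @smoothness_constant_expansion R p q G _ _ _ p12 pq G0.
move: (smoothness_constant p q G) C2 he => C C2 he.
have C0 : 0 <= C by rewrite (le_trans _ C2) ?powR_ge0.
have small y : `|y| <= 1 ->
    `|e - y| `^ q <= 1 - q * h y + q / p * (C * `|y| `^ p).
  move=> y1; apply: he => //.
  - by rewrite normr_ge0.
  - apply: (@le_trans _ _ `|e - y - e|); last first.
      by rewrite addrAC subrr sub0r normrN.
    by have := ler_dist_dist (e - y) e; rewrite e1.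
  - by have := hp y; rewrite addr0.
have pqI : 0 < p <= q by rewrite p0.
(* [powR_young] with [p] and [q] exchanged, at [b / beta], multiplied by [beta^p / p]. *)
have young b : 0 <= b ->
    q / p * b `^ p <= beta `^ (p - q) * b `^ q + (q - p) / p * beta `^ p.
  move=> b_ge0; have bb : 0 <= b / beta by rewrite divr_ge0// ltW.
  have := powR_young pqI bb.
  have bp : 0 < beta `^ p by rewrite powR_gt0.
  have div_powR r : (b / beta) `^ r = b `^ r / beta `^ r.
    rewrite powRM ?invr_ge0 ?(ltW b0)//.
    by rewrite -(powR_inv1 (ltW b0)) -powRrM mulN1r powRN.
  rewrite !div_powR powRB ?(gt_eqF b0) ?implybT// => hb.
  have := ler_wpM2l (ltW (divr_gt0 bp p0)) hb.
  set P := beta `^ p; set Q := beta `^ q.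
  have Qp : 0 < Q by rewrite powR_gt0.
  have -> : P / p * (q * (b `^ p / P)) = q / p * b `^ p.
    by field; rewrite !gt_eqF.
  move=> /le_trans; apply; rewrite le_eqVlt; apply/orP; left; apply/eqP.
  by field; rewrite !gt_eqF.
move=> y; set W := _ * beta `^ p; set V := _ * beta `^ (p - q).
have [y1|y1] := leP `|y| 1.
  apply: (le_trans (small y y1)).
  have := ler_wpM2l C0 (young `|y| (normr_ge0 y)); rewrite /W /V; lra.
have := @power_expansion_extend q (q / p * C) C _ C2 _ y (ltW y1).
rewrite (le_trans (ltW p1))// => /(_ isT _)/le_trans; apply.
  by move=> z z1; have := small z; rewrite z1 lexx powR1 mulr1; apply.
(* At [b = 1] this gives [q / p * C <= V + W]; with [C <= V], the bound extended from the unit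
   sphere stays below the claimed one. *)
have := ler_wpM2l C0 (young 1 ler01); rewrite !powR1 !mulr1 -/V -/W => h1.
have V1 : C <= V.
  rewrite /V ler_peMr// -[leLHS](powRr0 beta) ger_powR ?b0// subr_le0//.
have yq : 1 <= `|y| `^ q by rewrite -[leLHS](powRr0 `|y|) ler_powR// ltW.
have : 0 <= (V - C) * (`|y| `^ q - 1) by rewrite mulr_ge0 ?subr_ge0.
have : C * (beta `^ (p - q) + (q - p) / p * beta `^ p) = V + W.
  by rewrite /V /W; ring.
lra.
Qed.

(** For [0 < |y| <= 1], the choice [beta = |y|] makes the two error terms add up to
    [q / p * C * |y|^p]; [powR_young] then lowers the exponent on the left and cancels the factor
    [q / p]. *)
Lemma power_expansion_descend p q C : 1 < p <= q -> 2 `^ p <= C ->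
  (forall beta, 0 < beta <= 1 -> power_expansion q
    ((q - p) / p * C * beta `^ p) (C * beta `^ (p - q)) e h) ->
  power_expansion p 0 C e h.
Proof.
move=> /andP[p1 pq] C2 hq; apply/power_expansion1.
have p0 : 0 < p by rewrite (lt_trans ltr01).
have q0 : 0 < q by rewrite (lt_le_trans p0).
have C0 : 0 <= C by rewrite (le_trans _ C2) ?powR_ge0.
have small y : `|y| <= 1 -> `|e - y| `^ p <= 1 + 0 - p * h y + C * `|y| `^ p.
  move=> y1; have [->|yn] := eqVneq y 0.
    rewrite subr0 e1 powR1 linear0 mulr0 subr0 addr0 lerDl.
    by rewrite mulr_ge0 ?powR_ge0.
  have yp : 0 < `|y| by rewrite normr_gt0.
  have yI : 0 < `|y| <= 1 by rewrite yp.
  have /power_expansion1 /(_ y) := hq _ yI.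
  have yy : `|y| `^ (p - q) * `|y| `^ q = `|y| `^ p.
    by rewrite -powRD ?(gt_eqF yp) ?implybT// subrK.
  rewrite -[C * _ * _]mulrA yy -[_ / p * C * _]mulrA => hy.
  have pqI : 0 < p <= q by rewrite p0.
  rewrite addr0 -(ler_pM2l q0).
  apply: (le_trans (powR_young pqI (normr_ge0 (e - y)))).
  have := ler_wpM2l (ltW p0) hy.
  set W := C * `|y| `^ p.
  have -> : p * (1 + (q - p) / p * W - q * h y + W) = p - p * q * h y + q * W.
    by field; rewrite gt_eqF.
  lra.
move=> y; have [y1|y1] := leP `|y| 1; first exact: small.
have := @power_expansion_extend p C C (ltW p1) C2 _ y (ltW y1).
rewrite addr0 => /(_ _)/le_trans; apply; last by lra.
by move=> z z1; have := small z; rewrite z1 lexx powR1 mulr1 addr0; apply.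
Qed.

(* Adding the expansions at [e] along [t *: e] and [- t *: e] compares a      *)
(* second difference of order [t^2] with [t^p].                               *)
Lemma power_expansion_le2 p G : 1 < p -> 0 < G ->
  power_expansion p 0 G e h -> p <= 2.
Proof.
move=> p1 G0 /power_expansion1 hp; rewrite leNgt; apply/negP => p2.
have p0 : 0 < p by rewrite (lt_trans ltr01).
have half1 : 1 <= p / 2 by rewrite ler_pdivlMr// mul1r ltW.
have bern c : 0 <= c -> 1 + p / 2 * (c ^+ 2 - 1) <= c `^ p.
  move=> c0; have := bernoulli_powR half1 (sqr_ge0 c).
  by rewrite -powR_mulrn// -powRrM mulrCA divff ?mulr1 ?pnatr_eq0//; lra.
have key t : 0 < t < 1 -> p <= 2 * G * t `^ (p - 2).
  move=> /andP[t0 t1]; have [_ he] := neh.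
  have hn s : `|e - s *: e| = `|1 - s|.
    by rewrite -{1}(scale1r e) -scalerBl normrZ e1 mulr1.
  have := hp (t *: e); have := hp (- t *: e).
  rewrite !hn !normrZ !e1 !mulr1 opprK normrN (gtr0_norm t0) !linearZ /= he e1.
  rewrite (@gtr0_norm _ (1 + t)) ?addr_gt0// (@gtr0_norm _ (1 - t)) ?subr_gt0//.
  have t2 : t `^ p = t ^+ 2 * t `^ (p - 2).
    rewrite -powR_mulrn ?(ltW t0)// -powRD ?(gt_eqF t0) ?implybT//.
    by rewrite addrCA subrr addr0.
  have := bern (1 + t) (addr_ge0 ler01 (ltW t0)).
  have := bern (1 - t); rewrite subr_ge0 (ltW t1) => /(_ isT).
  rewrite /GRing.scale /= t2 => b1 b2 h1 h2.
  have t20 : 0 < t ^+ 2 by rewrite exprn_gt0.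
  rewrite -(ler_pM2l t20); lra.
(* Chosen so that [2 G m < p]; then [t = m^(1/(p-2))] contradicts [key]. *)
pose m := p / (2 * G + p).
have m0 : 0 < m by rewrite divr_gt0// addr_gt0// mulr_gt0.
have m1 : m < 1.
  by rewrite ltr_pdivrMr ?addr_gt0 ?mulr_gt0// mul1r ltrDr mulr_gt0.
have p20 : 0 < p - 2 by rewrite subr_gt0.
have := key (m `^ (p - 2)^-1).
rewrite -powRrM mulVf ?gt_eqF// powRr1 ?(ltW m0)// powR_gt0//=.
have -> : m `^ (p - 2)^-1 < 1.
  have := @gt0_ltr_powR R (p - 2)^-1 _ m 1; rewrite powR1 invr_gt0; apply => //;
  by rewrite nnegrE ltW.
move=> /(_ isT); rewrite leNgt => /negP; apply.
rewrite /m mulrA ltr_pdivrMr ?addr_gt0 ?mulr_gt0//.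
have : 0 < p * p by rewrite mulr_gt0.
lra.
Qed.

End Unit.
End Norming.

(** * Measurability and integration of the duality pairing *)

Section BochnerNorming.
Context d (T : measurableType d) (R : realType) (X : normedModType R).
Variables (mu : {measure set T -> \bar R}).
Local Open Scope quotient_scope.

Section Measurability.
Variables (p G : R) (h : X -> {linear X -> R^o}).
Hypotheses (p_gt1 : 1 < p)
  (h_norming : forall x, norming x (h x))
  (h_smooth : forall x, power_expansion p 0 G x (h x)).

Let p_gt0 : 0 < p. Proof. exact: lt_trans p_gt1. Qed.

(* The step sizes are chosen so that the error term of the difference         *)
(* quotient, of order [t^(p - 1)], is harmonic.                               *)
Let step (n : nat) : R := (n.+1%:R^-1) `^ (p - 1)^-1.

Let step_gt0 n : 0 < step n.
Proof. by rewrite powR_gt0// invr_gt0. Qed.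

Let step_powR n : step n `^ p = step n * n.+1%:R^-1.
Proof.
have s0 := step_gt0 n.
rewrite -[in LHS](subrK 1 p) powRD; last by rewrite (gt_eqF s0) implybT.
rewrite powRr1 ?(ltW s0)// -powRrM mulVf ?powRr1 ?invr_ge0// 1?mulrC//.
by rewrite gt_eqF// subr_gt0.
Qed.

(** The pairing is the directional derivative of [|x|^p / p]: smoothness bounds the quotient from
    below up to a vanishing error, the subgradient inequality from above. *)
Lemma difference_quotient_cvg (x y : X) :
  (step n)^-1 * ((`|x| `^ p - `|x - step n *: y| `^ p) / p) @[n --> \oo]
    --> (`|x| `^ (p - 1) * h x y : R).
Proof.
set l : R := _ * h x y.
apply: (@squeeze_cvgr _ _ _ _ (fun n => l - G / p * `|y| `^ p * n.+1%:R^-1)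
  (fun=> l)); last 2 first.
- rewrite -[X in _ --> X]subr0; apply: cvgB; first exact: cvg_cst.
  rewrite -[X in _ --> X](mulr0 (G / p * `|y| `^ p)).
  by apply: cvgMr => //; exact: cvg_harmonic.
- exact: cvg_cst.
apply: nearW => n; have s0 := step_gt0 n.
have hs : h x (step n *: y) = step n * h x y by rewrite linearZ.
rewrite -(ler_pM2l s0) -[X in _ && X](ler_pM2l s0) mulVKf ?gt_eqF//.
rewrite -(ler_pM2l p_gt0) -[X in _ && X](ler_pM2l p_gt0).
rewrite [p * (_ / p)]mulrC divfK ?gt_eqF//.
apply/andP; split.
  have := h_smooth x (step n *: y).
  rewrite addr0 mul1r hs normrZ (gtr0_norm s0) powRM ?(ltW s0)// step_powR.
  have -> : p * (step n * (l - G / p * `|y| `^ p / n.+1%:R)) =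
      p * step n * l - G * (step n / n.+1%:R * `|y| `^ p).
    have : n.+1%:R != 0 :> R by rewrite pnatr_eq0.
    by move: (n.+1%:R) => m m0; field; rewrite m0 gt_eqF.
  have -> : p * step n * l = p * `|x| `^ (p - 1) * (step n * h x y).
    by rewrite /l; ring.
  move: (G * _) => E; lra.
have := duality_map_subgradient (step n *: y) p_gt1
  (norming_duality_map p_gt1 (h_norming x)).
rewrite /= hs /GRing.scale /= -/l /l; lra.
Qed.

(** No measurability of [h] itself is assumed. For exponent [p] the pairing is a pointwise limit of
    measurable functions of norms; the factor [|f|^(q-p)] passes to [q], both sides being [0] where
    [f] vanishes. *)
Lemma measurable_duality_pairing (q : R) (f g : T -> X) : 1 < q ->
  strongly_measurable f -> strongly_measurable g ->
  measurable_fun [set: T] (fun t => `|f t| `^ (q - 1) * h (f t) (g t)).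
Proof.
move=> q1 mf mg.
have mn (k : T -> X) r : strongly_measurable k ->
    measurable_fun [set: T] (fun t => `|k t| `^ r).
  move=> mk; apply: (measurableT_comp (measurable_powR _)).
  exact: strongly_measurable_norm.
have mp : measurable_fun [set: T] (fun t => `|f t| `^ (p - 1) * h (f t) (g t)).
  apply: (@measurable_fun_cvg _ _ _ _ (fun n t => (step n)^-1 *
    ((`|f t| `^ p - `|f t - step n *: g t| `^ p) / p))); last first.
    by move=> t _; exact: difference_quotient_cvg.
  move=> n; apply: measurable_funM => //.
  apply: measurable_funM => //; apply: measurable_funB; first exact: mn.
  have := mn (- step n *: g + f) p (strongly_measurable_lin _ mg mf).
  by under eq_fun do rewrite /= scaleNr addrC.
have -> : (fun t => `|f t| `^ (q - 1) * h (f t) (g t)) =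
    (fun t => `|f t| `^ (q - p) * (`|f t| `^ (p - 1) * h (f t) (g t))).
  apply/funext => t; rewrite mulrA; congr (_ * _).
  have [->|f0] := eqVneq (f t) 0.
    rewrite normr0 [0 `^ (q - 1)]powR0 ?[0 `^ (p - 1)]powR0 ?mulr0//;
      by rewrite gt_eqF// subr_gt0.
  by rewrite -powRD ?normr_eq0 ?f0 ?implybT// subrKA.
by apply: measurable_funM => //; exact: mn.
Qed.

End Measurability.

Section Integration.
Variables (q : R) (q_gt1 : 1 < q) (q1 : 1 <= q) (h : X -> {linear X -> R^o}).
Hypothesis h_norming : forall x, norming x (h x).
Hypothesis h_measurable : forall f g : T -> X,
  strongly_measurable f -> strongly_measurable g ->
  measurable_fun [set: T] (fun t => `|f t| `^ (q - 1) * h (f t) (g t)).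

Notation Lq := (bochner_fun X mu q1).
Implicit Types (f g : Lq) (A B : R).

Let q_gt0 : 0 < q. Proof. exact: lt_trans q_gt1. Qed.

Definition real_bochner_norm f : R := fine (bochner_norm mu q f).
Local Notation N := real_bochner_norm.

Lemma real_bochner_norm_ge0 f : 0 <= N f.
Proof. by apply: fine_ge0; exact: bochner_norm_ge0. Qed.

Lemma bochner_strongly_measurable f : strongly_measurable f.
Proof. by have /bochner_functionP[] := bochner_valP f. Qed.

Lemma bochner_norm_powR f :
  (\int[mu]_t (`|f t| `^ q)%:E = (N f `^ q)%:E)%E.
Proof.
rewrite -poweR_EFin /real_bochner_norm fineK ?bochner_norm_fin_num//.
rewrite bochner_normE -poweRrM mulVf ?gt_eqF// poweRe1//.
by apply: integral_ge0 => t _; rewrite lee_fin powR_ge0.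
Qed.

Lemma bochner_norm_integrable f :
  mu.-integrable [set: T] (EFin \o (fun t => `|f t| `^ q)).
Proof.
apply/integrableP; split.
  exact: (measurable_normr_powR q (bochner_strongly_measurable f)).
under eq_integral do rewrite /= ger0_norm ?powR_ge0//.
by rewrite bochner_norm_powR ltry.
Qed.

Lemma Rintegral_bochner_norm f : \int[mu]_t (`|f t| `^ q) = N f `^ q.
Proof. by rewrite /Rintegral bochner_norm_powR. Qed.

Lemma bochner_hoelder f g :
  (\int[mu]_t (`|f t| `^ (q - 1) * `|g t|)%:E <= (N f `^ (q - 1) * N g)%:E)%E.
Proof.
have s0 : 0 < q - 1 by rewrite subr_gt0.
have conj : (q / (q - 1))^-1 + q^-1 = 1.
  by field; rewrite !gt_eqF.
have nf := strongly_measurable_norm (bochner_strongly_measurable f).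
have ng := strongly_measurable_norm (bochner_strongly_measurable g).
have nfq : measurable_fun [set: T] (fun t => `|f t| `^ (q - 1)).
  exact: (measurableT_comp (measurable_powR _)).
have := hoelder mu nfq ng (divr_gt0 q_gt0 s0) q_gt0 conj.
rewrite Lnorm1.
under eq_integral do rewrite /= ger0_norm ?mulr_ge0 ?powR_ge0//.
move=> /le_trans; apply.
have -> : ('N[mu]_q%:E[(EFin \o (fun t => `|g t|%R))] = (N g)%:E)%E.
  by rewrite /real_bochner_norm fineK// bochner_norm_fin_num.
suff -> : ('N[mu]_(q / (q - 1))%:E[(EFin \o (fun t => `|f t| `^ (q - 1))%R)]
    = (N f `^ (q - 1))%:E)%E by [].
rewrite unlock.
under eq_integral do
  rewrite /= norm_powR// normr_id -powRrM mulrCA divff ?gt_eqF// mulr1.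
rewrite bochner_norm_powR poweR_EFin -powRrM; congr (_ `^ _)%:E.
by field; rewrite !gt_eqF.
Qed.

Let pairing f g t : R := `|f t| `^ (q - 1) * h (f t) (g t).

Let pairing_le f g t : `|pairing f g t| <= `|f t| `^ (q - 1) * `|g t|.
Proof.
rewrite /pairing normrM ger0_norm ?powR_ge0// ler_wpM2l ?powR_ge0//.
by have [] := h_norming (f t).
Qed.

Let pairing_measurable f g : measurable_fun [set: T] (pairing f g).
Proof. by apply: h_measurable; exact: bochner_strongly_measurable. Qed.

Let pairing_abs f g :
  (\int[mu]_t `|(pairing f g t)%:E| <= (N f `^ (q - 1) * N g)%:E)%E.
Proof.
apply: le_trans (bochner_hoelder f g); apply: ge0_le_integral => //.
- by apply: measurableT_comp => //; apply/measurable_EFinP.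
- apply/measurable_EFinP; apply: measurable_funM.
    apply: (measurableT_comp (measurable_powR _)).
    exact: strongly_measurable_norm (bochner_strongly_measurable f).
  exact: strongly_measurable_norm (bochner_strongly_measurable g).
- by move=> t _; rewrite lee_fin; exact: pairing_le.
Qed.

Lemma pairing_integrable f g :
  mu.-integrable [set: T] (EFin \o pairing f g).
Proof.
apply/integrableP; split; first exact/measurable_EFinP.
by apply: (le_lt_trans (pairing_abs f g)); rewrite ltry.
Qed.

Let I f g : R := \int[mu]_t pairing f g t.

Let I_le f g : `|I f g| <= N f `^ (q - 1) * N g.
Proof.
rewrite -lee_fin EFin_normr_Rintegral//; last exact: pairing_integrable.
apply: le_trans (pairing_abs f g); apply: le_abse_integral => //.
exact/measurable_EFinP.
Qed.

Let I_self f : I f f = N f `^ q.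
Proof.
rewrite -Rintegral_bochner_norm; apply: eq_Rintegral => t _.
by rewrite /pairing (h_norming (f t)).2 mulrC mulr_powRB1.
Qed.

Let I_linear f a g1 g2 : I f (a *: g1 + g2) = a * I f g1 + I f g2.
Proof.
rewrite /I -RintegralZl//; last exact: pairing_integrable.
rewrite -RintegralD//; last 2 first.
- have := integrableZl measurableT a (pairing_integrable f g1).
  by [].
- exact: pairing_integrable.
apply: eq_Rintegral => t _; rewrite /pairing.
have -> : (a *: g1 + g2) t = a *: g1 t + g2 t by [].
by rewrite linearP mulrDr [in RHS]mulrCA.
Qed.

Let I_ae f g1 g2 : {ae mu, forall t, g1 t = g2 t} -> I f g1 = I f g2.
Proof.
move=> g12; congr fine; apply: ae_eq_integral => //.
- exact/measurable_EFinP.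
- exact/measurable_EFinP.
- by apply: filterS g12 => t /= gt _; rewrite /pairing gt.
Qed.

Let I_expansion A B f g :
  (forall x, power_expansion q A B x (h x)) ->
  N (f - g) `^ q <= (1 + A) * N f `^ q - q * I f g + B * N g `^ q.
Proof.
move=> hx; rewrite -!Rintegral_bochner_norm.
have If := bochner_norm_integrable f.
have Ig := bochner_norm_integrable g.
have Ip := pairing_integrable f g.
have IA := integrableZl measurableT (1 + A) If.
have IB := integrableZl measurableT B Ig.
have Iq := integrableZl measurableT q Ip.
rewrite -(RintegralZl (1 + A))// -(RintegralZl q)// -(RintegralZl B)//.
rewrite -RintegralB// -RintegralD//; last first.
  exact: (integrableB measurableT IA Iq).
apply: le_Rintegral => //.
- exact: bochner_norm_integrable.
- exact: (integrableD measurableT (integrableB measurableT IA Iq) IB).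
- move=> t _; have := hx (f t) (g t).
  by rewrite /pairing mulrA.
Qed.

(** One functional [L] serves all [A] and [B], which lets [beta] vary after integration. It is well
    defined on classes by [I_ae], bounded by Hoelder through [I_le], and inherits expansions by
    integration ([I_expansion]). *)
Lemma bochner_norming (u : Bochner X mu q1) :
  exists2 L : {linear Bochner X mu q1 -> R^o}, norming u L &
    forall A B, (forall x, power_expansion q A B x (h x)) ->
      power_expansion q A B u L.
Proof.
pose f := repr u.
have uE : `|u| = N f by [].
have nE (v : Bochner X mu q1) : `|v| = N (repr v) by [].
pose L0 (v : Bochner X mu q1) : R^o := N f `^ (1 - q) * I f (repr v).
have L0_linear : linear L0.
  move=> a v w; rewrite /L0.
  have -> : I f (repr (a *: v + w)) = I f (a *: repr v + repr w).
    apply: I_ae; have := bochner_reprP (a *: repr v + repr w).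
    by rewrite bochner_piD bochner_piZ !reprK.
  by rewrite I_linear mulrDr mulrCA.
pose L : {linear Bochner X mu q1 -> R^o} :=
  HB.pack L0 (GRing.isLinear.Build _ _ _ _ L0 L0_linear).
have LE v : N f `^ (q - 1) * L v = I f (repr v).
  (* For [N f = 0] the powers do not cancel, but [I_le] forces the integral to vanish. *)
  have [f0|f0] := eqVneq (N f) 0.
    have := I_le f (repr v); rewrite f0 powR0 ?gt_eqF ?subr_gt0//.
    by rewrite !mul0r normr_le0 => /eqP ->.
  rewrite [L v]/(L0 v) /L0 mulrA -powRD ?f0 ?implybT//.
  by rewrite addrA subrK subrr powRr0 mul1r.
exists L.
  split=> [v|].
    rewrite [L v]/(L0 v) /L0 nE normrM ger0_norm ?powR_ge0//.
    have [f0|f0] := eqVneq (N f) 0.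
      have := I_le f (repr v).
      rewrite f0 [0 `^ (q - 1)]powR0 ?gt_eqF ?subr_gt0//.
      rewrite mul0r normr_le0 => /eqP ->.
      by rewrite normr0 mulr0 real_bochner_norm_ge0.
    have := ler_wpM2l (powR_ge0 (N f) (1 - q)) (I_le f (repr v)).
    by rewrite mulrA -powRD ?f0 ?implybT// addrA subrK subrr powRr0 mul1r.
  rewrite [L u]/(L0 u) /L0 I_self uE.
  have [->|f0] := eqVneq (N f) 0; first by rewrite [0 `^ q]powR0 ?mulr0 ?gt_eqF.
  rewrite -powRD ?f0 ?implybT// subrK powRr1//.
  exact: real_bochner_norm_ge0.
move=> A B hx v; rewrite -(mulrA q) uE LE !nE.
have := I_expansion f (repr v) hx; congr (_ <= _); congr (_ `^ _).
congr fine; apply: eq_bochner_norm; move: (bochner_reprP (f - repr v)).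
have -> : \pi_(Bochner X mu q1) (f - repr v) = u - v.
  by rewrite -scaleN1r addrC bochner_piD bochner_piZ !reprK scaleN1r addrC.
by apply: filterS => t ->.
Qed.

End Integration.
End BochnerNorming.

(** * Power-type smoothness of the Lebesgue-Bochner space *)

Section BochnerSmooth.
Context d (T : measurableType d) (R : realType) (X : normedModType R).
Variables (mu : {measure set T -> \bar R}) (p q G : R) (q1 : 1 <= q).
Hypotheses (p_gt1 : 1 < p) (q_gt1 : 1 < q) (X_smooth : power_smooth X p G).

Lemma bochner_power_smooth_lower C : q <= p -> G <= C -> 2 `^ q <= C ->
  power_smooth (Bochner X mu q1) q C.
Proof.
move=> qp GC C2; have [G0 [h hP]] := (power_smoothP X G p_gt1).1 X_smooth.
have hn x := (hP x).1; have hs x := (hP x).2.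
have C1 : 1 <= C.
  rewrite (le_trans _ C2)// -[leLHS](powRr0 2) ler_powR ?ler1n//.
  by rewrite ltW// (lt_trans ltr01).
apply/power_smoothP => //; split; first by rewrite (lt_le_trans ltr01).
have hq x : power_expansion q 0 C x (h x).
  have [->|x0] := eqVneq x 0; first exact: power_expansion0.
  have [e1 ne] := unit_norming x0 (hn x).
  apply/(power_expansion_unit _ _ _ _ x0).
  have qpI : 1 < q <= p by rewrite q_gt1.
  apply: (power_expansion_lower e1 ne qpI G0 GC C2).
  exact/(power_expansion_unit _ _ _ _ x0).
suff /choice[L LP] : forall u : Bochner X mu q1, exists L,
    norming u L /\ power_expansion q 0 C u L by exists L.
move=> u; have hm := @measurable_duality_pairing d T R X p G h p_gt1 hn hs q.
have [L nL eL] := bochner_norming q_gt1 hn (fun f g => hm f g q_gt1) u.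
by exists L; split => //; exact: eL.
Qed.

Lemma bochner_power_smooth_raise : p <= q ->
  power_smooth (Bochner X mu q1) p (smoothness_constant p q G).
Proof.
move=> pq; have [G0 [h hP]] := (power_smoothP X G p_gt1).1 X_smooth.
have hn x := (hP x).1; have hs x := (hP x).2.
have C2 := smoothness_constant_ge p q G.
set C := smoothness_constant p q G in C2 *.
have p0 : 0 < p by rewrite (lt_trans ltr01).
have C2p : 2 `^ p <= C by rewrite (le_trans _ C2)// ler_powR ?ler1n.
have C1 : 1 <= C.
  by rewrite (le_trans _ C2p)// -[leLHS](powRr0 2) ler_powR ?ler1n// ltW.
have hq beta : 0 < beta <= 1 -> forall x, power_expansion q
    ((q - p) / p * C * beta `^ p) (C * beta `^ (p - q)) x (h x).
  move=> bI x; have /andP[b0 b1] := bI.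
  have [->|x0] := eqVneq x 0.
    apply: power_expansion0 => //; apply: mulr_ege1 => //.
    by rewrite -[leLHS](powRr0 beta) ger_powR// subr_le0.
  have [e1 ne] := unit_norming x0 (hn x).
  have he := (power_expansion_unit p 0 G (h x) x0).2 (hs x).
  (* The nonzero vector [x] forces [p <= 2], which [power_expansion_raise] requires. *)
  have p2 := power_expansion_le2 e1 ne p_gt1 G0 he.
  apply/(power_expansion_unit _ _ _ _ x0).
  by apply: power_expansion_raise => //; rewrite p_gt1.
apply/power_smoothP => //; split; first by rewrite (lt_le_trans ltr01).
suff /choice[L LP] : forall u : Bochner X mu q1, exists L,
    norming u L /\ power_expansion p 0 C u L by exists L.
move=> u; have hm := @measurable_duality_pairing d T R X p G h p_gt1 hn hs q.
have [L nL eL] := bochner_norming q_gt1 hn (fun f g => hm f g q_gt1) u.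
exists L; split => //.
have [->|u0] := eqVneq u 0; first exact: power_expansion0.
have [e1 ne] := unit_norming u0 nL.
apply/(power_expansion_unit _ _ _ _ u0).
apply: (@power_expansion_descend _ _ _ _ e1 ne p q) => //.
  by rewrite p_gt1.
move=> beta bI; apply/(power_expansion_unit _ _ _ _ u0).
by apply: eL; exact: hq.
Qed.

End BochnerSmooth.

Theorem lemma2p26 (R : realType) (X : completeNormedModType R) (p q T GX : R)
    (p_gt1 : 1 < p) (q_gt1 : 1 < q) (T_gt0 : 0 < T)
    (X_smooth : power_smooth X p GX) :
  let LqX := Bochner_interval X (ltW q_gt1) T in
  let K := lipschitz_constant `[2^-1, 1] (fun h : R => h `^ (q - p)) in
  let K' := lipschitz_constant `[2^-1, 1] (fun h : R => h `^ (p - q)) in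
  [/\ exists G : R, power_smooth LqX (Num.min p q) G,
      q = Num.min p q ->
        power_smooth LqX q
          (2 `^ (p - q) * Num.max (2 `^ p) (GX + K * 2 `^ (p - 2))) &
      p = Num.min p q ->
        power_smooth LqX p
          (Num.max (2 `^ q) (2 `^ (q - p) * GX + K * 2 `^ (q - 2))
           + K' * 2 `^ (p - 2))].
Proof.
move=> LqX K K'.
have [G0 _] := X_smooth.
have lower : q <= p -> power_smooth LqX q
    (2 `^ (p - q) * Num.max (2 `^ p) (GX + K * 2 `^ (p - 2))).
  move=> qp.
  have D1 : 1 <= 2 `^ (p - q) :> R.
    by rewrite -[leLHS](powRr0 2) ler_powR ?ler1n// subr_ge0.
  have K0 : 0 <= K * 2 `^ (p - 2).
    by rewrite mulr_ge0 ?powR_ge0// lipschitz_constant_ge0.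
  (* [bochner_power_smooth_lower] accepts any constant above [GX] and [2^q]; the stated one
     qualifies because its factor [2^(p-q)] is at least [1]. *)
  have max_le : Num.max (2 `^ p) (GX + K * 2 `^ (p - 2)) <=
      2 `^ (p - q) * Num.max (2 `^ p) (GX + K * 2 `^ (p - 2)).
    by rewrite ler_peMl// le_max powR_ge0.
  apply: (bochner_power_smooth_lower _ _ p_gt1 q_gt1 X_smooth qp);
    apply: le_trans max_le; rewrite le_max.
    by rewrite lerDl K0 orbT.
  by rewrite ler_powR ?ler1n.
have raise : p <= q -> power_smooth LqX p (smoothness_constant p q GX).
  exact: (bochner_power_smooth_raise _ _ p_gt1 q_gt1 X_smooth).
split=> [|qE|pE].
- have [pq|qp] := leP p q; eexists; [exact: raise|exact/lower/ltW].
- by apply: lower; rewrite qE ge_min lexx.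
- by apply: raise; rewrite pE ge_min lexx orbT.
Qed.
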